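(* Let $p$ be a positive rational prime. The family $\mathcal{F}_p$ of irreducible polynomials associated with $p$ can be generated from the seed polynomial $\Phi_p(x)=x^{p-1}+\cdots+x+1$ by the following rules (that is, every element of $\mathcal{F}_p$ can be obtained from $\Phi_p(x)$ by applying these rules): (1) the ascent procedure, which converts $f_p^{(b)}(x)$ into $f_p^{(b+a)}(x)$ for $a,b\in\mathbb{N}$ (note $f_p^{(1)}=\Phi_p$); (2) replacing selected coefficients $a_i$ of a polynomial $f_p^{(b)}(x)$ by the linear digit $x-(b-a_i)$ (i.e. replacing the term $a_ix^i$ by $(x-(b-a_i))x^i$ for all $i$ in some finite set of indices); this can be done for finitely many zero coefficients as well, including those associated with $x^n$ where $n>\deg f_p^{(b)}(x)$.
   Context: $\mathbb{N}$ is the set of positive integers. For $c\in\mathbb{N}$: $f_c^{(1)}(x)=x^{c-1}+\cdots+x+1$, and for $b\ge2$, $f_c^{(b)}(x)=\sum a_ix^i$ where $c=\sum a_ib^i$ is the base-$b$ expansion of $c$ (digits $0\le a_i\le b-1$). A polynomial in $\mathbb{Z}[x]$ is positive if its leading coefficient is positive; a non-constant polynomial is proper if the gcd of its values at all integers is $1$; a PPI-polynomial is a (non-constant) positive, proper polynomial irreducible in $\mathbb{Z}[x]$. Every positive polynomial $g$ has a unique base-$x$ representation $\sum_{i=0}^m b_i(x)x^i$ with digits $b_i(x)\in\{0,1,2,\dots\}\cup\{x-1,x-2,\dots\}$, $b_m(x)\ne0$; $\mathrm{MB}(g)$ is the least positive integer $a$ such that all its digits lie in $\{0,\dots,a-1\}\cup\{x-1,\dots,x-a\}$.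 $\mathcal{F}_p$ is the set consisting of the constant polynomial $p$, the cyclotomic polynomial $\Phi_p(x)$, and every PPI-polynomial $g(x)\in\mathbb{Z}[x]$ such that $g(b)=p$ for some integer $b\ge \mathrm{MB}(g)$. Ascent procedure from base $b$ to base $b+a$ applied to $f=f_c^{(b)}$: (a) form $f(x-a)$ and simplify; (b) replace each nonzero coefficient $\pm n$ ($n>0$) by $\pm f_n^{(b+a)}(x)$ and simplify; (c) if every coefficient now has absolute value strictly less than $b+a$, go to (d), otherwise return to (b); (d) write the polynomial in base $x$, replace each digit of the form $x-j$ by $b+a-j$, and simplify. *)

(* Defs.v *)
From mathcomp Require Import all_boot all_order all_algebra all_field.

Set Implicit Arguments.
Unset Strict Implicit.
Unset Printing Implicit Defensive.

Import Order.TTheory GRing.Theory Num.Theory.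
Local Open Scope ring_scope.

(* f_c^(b). The digit of c at b ^ i is (c %/ b ^ i) %% b, which vanishes for
   i >= c when b >= 2; base 1 is the unary expansion x^(c-1) + ... + x + 1.
   Only meant for c > 0 and b > 0. *)
Definition base_poly (c b : nat) : {poly int} :=
  \poly_(i < c) (if b == 1%N then 1 else ((c %/ b ^ i) %% b)%N%:Z).

Lemma base_poly_eval (c b : nat) :
  (0 < b)%N -> (base_poly c b).[b%:Z] = c%:Z.
Proof.
move=> b_gt0; rewrite /base_poly horner_poly.
case: eqVneq => [->|b_neq1].
  under eq_bigr => i _ do rewrite expr1n mulr1.
  by rewrite sumr_const card_ord natz.
have b_gt1 : (1 < b)%N by rewrite ltn_neqAle eq_sym b_neq1.
have sumE m : (\sum_(i < m) (c %/ b ^ i) %% b * b ^ i = c %% b ^ m)%N.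
  elim: m => [|m IHm]; first by rewrite big_ord0 expn0 modn1.
  rewrite big_ord_recr /= IHm expnSr.
  rewrite modn_divl -expnS expnSr addnC [RHS](divn_eq _ (b ^ m)).
  by rewrite modn_dvdm ?dvdn_mulr.
transitivity ((\sum_(i < c) (c %/ b ^ i) %% b * b ^ i)%N%:Z).
  rewrite -[RHS]natz natr_sum; apply: eq_bigr => i _.
  by rewrite natrM natrX !natz.
by rewrite sumE modn_small // ltn_expl.
Qed.

Lemma base_poly_digit (c b i : nat) :
  (1 < b)%N -> 0 <= (base_poly c b)`_i < b%:Z.
Proof.
move=> b_gt1; rewrite coef_poly; case: ifP => _; last by rewrite lexx ltz_nat ltnW.
by rewrite gtn_eqF // lez_nat ltz_nat leq0n ltn_mod ltnW.
Qed.

Lemma base_poly1_Phi (p : nat) : prime p -> base_poly p 1 = 'Phi_p.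
Proof.
move=> p_pr; have p_gt0 := prime_gt0 p_pr.
have X1_neq0 : 'X - 1 != 0 :> {poly int}.
  by rewrite -(polyC1) monic_neq0 // monicXsubC.
apply: (mulfI X1_neq0); have := prod_Cyclotomic p_gt0.
have -> : divisors p = [:: 1%N; p].
  apply: (irr_sorted_eq ltn_trans ltnn (sorted_divisors_ltn p)).
    by rewrite /= prime_gt1.
  move=> d; rewrite -dvdn_divisors // !inE.
  apply/idP/orP => [/(primeP p_pr).2/orP //|].
  by case=> /eqP->; rewrite ?dvd1n ?dvdnn.
rewrite big_cons big_seq1.
have := prod_Cyclotomic (isT : (0 < 1)%N).
rewrite (_ : divisors 1 = [:: 1%N]) // big_seq1 => -> ->; rewrite subrX1; congr (_ * _).
rewrite /base_poly poly_def; apply: eq_bigr => i _; exact: scale1r.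
Qed.

(* [Cst n] is the digit n and [Lin j] the digit x - j, legal only for j > 0. *)
Inductive digit : Type := Cst of nat | Lin of nat.

Definition digit_ok (d : digit) : bool :=
  match d with Cst _ => true | Lin j => (0 < j)%N end.

Definition digit_poly (d : digit) : {poly int} :=
  match d with Cst n => n%:Z%:P | Lin j => 'X - j%:Z%:P end.

Definition digit_lt (a : nat) (d : digit) : bool :=
  match d with Cst n => (n < a)%N | Lin j => (j <= a)%N end.

(* s lists the base-x digits of g, least significant first. *)
Definition base_x_rep (g : {poly int}) (s : seq digit) : Prop :=
  [/\ all digit_ok s,
      digit_poly (last (Cst 0) s) != 0 &
      g = \sum_(i < size s) digit_poly (nth (Cst 0) s i) * 'X^i].

Definition is_MB (g : {poly int}) (a : nat) : Prop :=
  exists2 s, base_x_rep g s &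
    [/\ (0 < a)%N, all (digit_lt a) s &
        forall a', (0 < a')%N -> all (digit_lt a') s -> (a <= a')%N].

Definition proper_poly (g : {poly int}) : Prop :=
  (1 < size g)%N /\
  forall d : nat, (forall n : int, (d%:Z %| g.[n])%Z) -> d = 1%N.

(* Irreducibility in the ring Z[x]. MathComp's [irreducible_poly] over int is
   not this notion: it uses pseudo-division and ignores constant factors. *)
Definition irreducible_Zx (g : {poly int}) : Prop :=
  [/\ g != 0, g \isn't a GRing.unit &
      forall q r : {poly int}, g = q * r ->
        q \is a GRing.unit \/ r \is a GRing.unit].

Definition PPI (g : {poly int}) : Prop :=
  [/\ 0 < lead_coef g, proper_poly g & irreducible_Zx g].

Definition prime_family (p : nat) (g : {poly int}) : Prop :=
  [\/ g = p%:Z%:P,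
      g = 'Phi_p |
      PPI g /\ exists (a : nat) (b : int), [/\ is_MB g a, a%:Z <= b & g.[b] = p%:Z]].

(* Replaces every coefficient +-n (n > 0) by +-f_n^(B). *)
Definition expand_coefs (B : nat) (h : {poly int}) : {poly int} :=
  \sum_(i < size h) sgz h`_i *: base_poly (absz h`_i) B * 'X^i.

Definition coefs_small (B : nat) (h : {poly int}) : Prop :=
  forall i : nat, `|h`_i| < B%:Z.

(* The loop (b)-(c): expand at least once, until all coefficients are small. *)
Inductive expand_loop (B : nat) (h : {poly int}) : {poly int} -> Prop :=
| Expand_stop : coefs_small B (expand_coefs B h) ->
    expand_loop B h (expand_coefs B h)
| Expand_again h' : ~ coefs_small B (expand_coefs B h) ->
    expand_loop B (expand_coefs B h) h' -> expand_loop B h h'.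

Definition digit_subst (B : nat) (d : digit) : int :=
  match d with Cst n => n%:Z | Lin j => B%:Z - j%:Z end.

(* The ascent procedure from base b to base b + a terminates on f, with
   output g. *)
Definition ascent (b a : nat) (f g : {poly int}) : Prop :=
  exists (h : {poly int}) (s : seq digit),
    [/\ expand_loop (b + a) (f \Po ('X - a%:Z%:P)) h,
        base_x_rep h s &
        g = \sum_(i < size s) (digit_subst (b + a) (nth (Cst 0) s i))%:P * 'X^i].

(* Replaces a_i x^i by (x - (b - a_i)) x^i for all i in I, where f is the
   polynomial with coefficients a_i; I may contain indices beyond deg f. *)
Definition linearize (b : nat) (I : seq nat) (f : {poly int}) : {poly int} :=
  \sum_(i < maxn (size f) (\max_(k <- I) k.+1))
    (if (i : nat) \in I then 'X - (b%:Z - f`_i)%:P else (f`_i)%:P) * 'X^i.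

Inductive generable (p : nat) : {poly int} -> Prop :=
| Gen_seed : generable p 'Phi_p
| Gen_ascent (b a : nat) (g : {poly int}) : (0 < b)%N -> (0 < a)%N ->
    generable p (base_poly p b) -> ascent b a (base_poly p b) g ->
    generable p g
| Gen_linearize (b : nat) (I : seq nat) : (0 < b)%N ->
    generable p (base_poly p b) ->
    generable p (linearize b I (base_poly p b)).

(* Main.v *)
(* Evaluation at B = b + a is an invariant of the ascent procedure: f(x - a) and
   all its expansions take the value p at B. An expansion strictly decreases
   the sum of the absolute values of the coefficients as long as one of them
   reaches B, so the loop stops at a polynomial h with h(B) = p and coefficients
   in (-B, B). The base-x digits of such an h become base-B digits at x = B, so
   substituting B in them gives the base-B expansion of p. In the same way, the
   base-x digits of g, evaluated at b >= MB(g), are the base-b digits of g(b) = p,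
   and g is recovered from f_p^(b) by making its digits x - j linear again. *)
Require Import Defs.
From mathcomp Require Import all_boot all_order all_algebra all_field.
From mathcomp Require Import zify.

Set Implicit Arguments.
Unset Strict Implicit.
Unset Printing Implicit Defensive.

Import Order.TTheory GRing.Theory Num.Theory.
Local Open Scope ring_scope.

(** * Sign and uniqueness of values at [B] for coefficients in [(-B, B)] *)

(** With [n] the degree, the leading term contributes at least [B^n], while the lower ones
    contribute at least [-(B - 1)(1 + ... + B^(n-1)) = 1 - B^n]; at least 1 remains. *)
Lemma small_horner_gt0 (B : nat) (q : {poly int}) :
  coefs_small B q -> 0 < lead_coef q -> 0 < q.[B%:Z].
Proof.
move=> q_small lead_gt0.
have size_q : (0 < size q)%N.
  by rewrite size_poly_gt0 -lead_coef_eq0 gt_eqF.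
rewrite horner_coef -(prednK size_q) big_ord_recr /=.
set n := (size q).-1; rewrite -[q`_n]/(lead_coef q).
have low : - (B%:Z ^+ n - 1) <= \sum_(i < n) q`_i * B%:Z ^+ i.
  rewrite subrX1 mulr_sumr -sumrN; apply: ler_sum => i _.
  rewrite -mulNr; apply: ler_wpM2r; first exact: exprn_ge0.
  by have := q_small i; lia.
have top : B%:Z ^+ n <= lead_coef q * B%:Z ^+ n.
  by rewrite ler_peMl ?exprn_ge0.
by apply: lt_le_trans (lerD low top); rewrite opprB subrK.
Qed.

Lemma small_lead_gt0 (B : nat) (q : {poly int}) :
  coefs_small B q -> 0 < q.[B%:Z] -> 0 < lead_coef q.
Proof.
move=> q_small q_gt0; case: (ltrgt0P (lead_coef q)) => // [lead_lt0|/eqP].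
  have Nq_small : coefs_small B (- q) by move=> i; rewrite coefN normrN.
  have := @small_horner_gt0 B (- q); rewrite lead_coefN oppr_gt0 hornerN.
  by move=> /(_ Nq_small lead_lt0); rewrite oppr_gt0 lt_gtF.
by rewrite lead_coef_eq0 => /eqP q0; rewrite q0 horner0 in q_gt0.
Qed.

Lemma small_horner_eq0 (B : nat) (q : {poly int}) :
  coefs_small B q -> q.[B%:Z] = 0 -> q = 0.
Proof.
move=> q_small q0; apply/eqP; rewrite -lead_coef_eq0.
case: (ltrgt0P (lead_coef q)) => // lead_q.
  by have := small_horner_gt0 q_small lead_q; rewrite q0.
have Nq_small : coefs_small B (- q) by move=> i; rewrite coefN normrN.
have := small_horner_gt0 Nq_small.
by rewrite lead_coefN oppr_gt0 hornerN q0 => /(_ lead_q).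
Qed.

(** The difference of two polynomials with coefficients in [[0, B)] has coefficients in [(-B, B)],
    so it is zero as soon as it vanishes at [B]. *)
Lemma base_poly_unique (c B : nat) (q : {poly int}) : (1 < B)%N ->
  (forall i, 0 <= q`_i < B%:Z) -> q.[B%:Z] = c%:Z -> q = base_poly c B.
Proof.
move=> B_gt1 q_digit q_eval; apply/eqP; rewrite -subr_eq0; apply/eqP.
apply: (@small_horner_eq0 B) => [i|].
  rewrite coefB; have := q_digit i; have := base_poly_digit c i B_gt1.
  by move: (_`_i) (_`_i) => x y; lia.
by rewrite hornerD hornerN q_eval base_poly_eval ?subrr // ltnW.
Qed.

Lemma base_poly_small (c B : nat) : (1 < B)%N -> (c < B)%N ->
  base_poly c B = c%:Z%:P.
Proof.
move=> B_gt1 c_lt; apply/esym/base_poly_unique => //; last by rewrite hornerC.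
by move=> i; rewrite coefC; case: ifP => _; lia.
Qed.

(** * Base-x digits and their values at [x = B] *)

(** The interpretation [F] of a digit is a parameter, so that the polynomial represented in base x
    and the one obtained by substituting [B] in its digits are two instances. *)
Definition digits_sum (F : digit -> {poly int}) (s : seq digit) : {poly int} :=
  \sum_(i < size s) F (nth (Cst 0) s i) * 'X^i.

Lemma digits_sum_cons F d s :
  digits_sum F (d :: s) = F d + digits_sum F s * 'X.
Proof.
rewrite /digits_sum /= big_ord_recl /= expr0 mulr1 mulr_suml; congr (_ + _).
by apply: eq_bigr => i _; rewrite /bump add1n exprSr mulrA.
Qed.

(** Digits are extracted from the constant term up. For [q = r x + c] with [c >= 0] the digit is [c]
    and [r] remains; for [c < 0] a borrow gives [q = (r - 1) x + (x - |c|)], and [r - 1] remains. *)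
Lemma base_x_rep_exists (h : {poly int}) : 0 < lead_coef h ->
  exists s, base_x_rep h s.
Proof.
(* The default [Cst 1] lets the empty sequence represent 0. *)
have rep n (q : {poly int}) : (size q <= n)%N -> 0 <= lead_coef q ->
    exists s, [/\ all digit_ok s, digit_poly (last (Cst 1) s) != 0 &
                  q = digits_sum digit_poly s].
  have rep0 : exists s, [/\ all digit_ok s, digit_poly (last (Cst 1) s) != 0 &
                            0 = digits_sum digit_poly s].
    by exists [::]; split=> //; rewrite ?polyC_eq0 // /digits_sum big_ord0.
  elim: n q => [|n IHn] q; first by rewrite leqn0 size_poly_eq0 => /eqP ->.
  have [->|] := eqVneq q 0; first by move=> _ _.
  elim/poly_ind: q => [|r c _] q_neq0; first by rewrite eqxx in q_neq0.
  rewrite size_MXaddC; case: ifP => [/andP[/eqP r0 /eqP c0]|_].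
    by rewrite r0 c0 mul0r add0r eqxx in q_neq0.
  rewrite ltnS => size_r lead_q.
  have lead_r : r != 0 -> lead_coef (r * 'X + c%:P) = lead_coef r.
    move=> r_neq0; rewrite lead_coefDl ?lead_coefMX // size_mulX //.
    by rewrite ltnS (leq_trans (size_polyC_leq1 c)) // size_poly_gt0.
  have [c_ge0|c_lt0] := leP 0 c.
    have [||s [ok_s last_s r_s]] := IHn r => //.
      by have [->|r_neq0] := eqVneq r 0; rewrite ?lead_coef0 // -lead_r.
    exists (Cst `|c|%N :: s); split; rewrite ?digits_sum_cons -?r_s //=; last first.
      by rewrite gez0_abs // addrC.
    (* If no higher digit follows, then [r = 0], and [q != 0] makes [c] a nonzero top digit. *)
    case: s last_s r_s {ok_s} => //= _; rewrite /digits_sum big_ord0 => r0.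
    by move: q_neq0; rewrite r0 mul0r add0r gez0_abs.
  have r_neq0 : r != 0.
    by apply: contraTneq lead_q => ->; rewrite mul0r add0r lead_coefC -ltNge.
  have lead_r_gt0 : 0 < lead_coef r.
    by rewrite lt_def lead_coef_eq0 r_neq0 -lead_r.
  have [||s [ok_s last_s r_s]] := IHn (r - 1).
  - rewrite (leq_trans (size_polyD _ _)) // size_polyN size_poly1 geq_max size_r.
    by rewrite (leq_trans _ size_r) // size_poly_gt0.
  (* For constant [r] the borrow may leave 0, hence the weak inequality on the leading coefficient
     in [rep]. *)
  - have [size_r1|size_r1] := leqP (size r) 1.
      move: lead_r_gt0; rewrite (size1_polyC size_r1) -polyCB !lead_coefC; lia.
    by rewrite lead_coefDl ?size_polyN ?size_poly1 // ltW.
  exists (Lin `|c|%N :: s); split; rewrite ?digits_sum_cons -?r_s /=.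
  - by rewrite ok_s andbT absz_gt0 lt_eqF.
  - case: s last_s {ok_s r_s} => //= _.
    by rewrite -size_poly_eq0 size_XsubC.
  - by rewrite ltz0_abs // polyCN opprK mulrBl mul1r [RHS]addrC addrA subrK.
move=> lead_h; have [s [ok_s last_s h_s]] := rep _ h (leqnn _) (ltW lead_h).
exists s; split=> //; case: s h_s last_s {ok_s} => // h0.
by rewrite h0 /digits_sum big_ord0 lead_coef0 in lead_h.
Qed.

Lemma digits_sum_subst_eval (B : nat) (s : seq digit) :
  (digits_sum (fun d => (digit_subst B d)%:P) s).[B%:Z]
    = (digits_sum digit_poly s).[B%:Z].
Proof.
rewrite /digits_sum !horner_sum; apply: eq_bigr => i _; rewrite !hornerM.
by case: (nth _ _ _) => n; rewrite /= ?hornerXsubC ?hornerC.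
Qed.

Lemma coef_digits_sum_subst (B : nat) (s : seq digit) (i : nat) :
  (digits_sum (fun d => (digit_subst B d)%:P) s)`_i
    = digit_subst B (nth (Cst 0) s i).
Proof.
elim: s i => [|d s IHs] i.
  by rewrite /digits_sum big_ord0 coef0 nth_nil.
rewrite digits_sum_cons coefD coefMX coefC.
by case: i => [|i]; rewrite ?addr0 ?add0r.
Qed.

Lemma digit_subst_bound (B : nat) (d : digit) :
  digit_ok d -> digit_lt B d -> 0 <= digit_subst B d < B%:Z.
Proof. by case: d => n /=; lia. Qed.

Lemma digits_sum_subst (B p : nat) (s : seq digit) : (1 < B)%N ->
  all digit_ok s -> all (digit_lt B) s -> (digits_sum digit_poly s).[B%:Z] = p%:Z ->
  digits_sum (fun d => (digit_subst B d)%:P) s = base_poly p B.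
Proof.
move=> B_gt1 ok_s lt_s s_eval; apply: base_poly_unique => // [i|].
  rewrite coef_digits_sum_subst; have [i_lt|i_ge] := ltnP i (size s).
    by apply: digit_subst_bound; apply: all_nthP.
  by rewrite nth_default //=; lia.
by rewrite digits_sum_subst_eval.
Qed.

Definition is_lin (d : digit) : bool := if d is Lin _ then true else false.

(** A digit [x - j] adds [-j] to its own coefficient and 1 to the next. Each coefficient is thus [n]
    or [-j] plus a carry 0 or 1, and absolute value below [B] forces [n < B] or [j <= B]. *)
Lemma small_digit_lt (B : nat) (s : seq digit) :
  coefs_small B (digits_sum digit_poly s) -> all (digit_lt B) s.
Proof.
(* [carry] is the contribution of the linear digit just below [s]. *)
have gen (carry : bool) : (forall i,
    `|(digits_sum digit_poly s + (carry : nat)%:Z%:P)`_i| < B%:Z) ->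
    all (digit_lt B) s.
  elim: s carry => //= d s IHs carry; rewrite digits_sum_cons => small.
  apply/andP; split.
    have := small 0; rewrite !coefD coefMX coefC /=.
    by case: d {small} => n; rewrite /= ?coefB ?coefX coefC /=; case: carry; lia.
  apply: (IHs (is_lin d)) => i.
  have := small i.+1; rewrite !coefD coefMX !coefC /= addr0.
  suff -> : (digit_poly d)`_i.+1 = if i == 0 then (is_lin d)%:Z else 0.
    by rewrite addrC.
  by case: d {small} => n; rewrite /= ?coefB ?coefX coefC /=; case: i => [|i].
by move=> small; apply: (gen false) => i; rewrite addr0.
Qed.

(** * Termination and invariants of the expansion loop *)

(** The termination measure of the loop, valued in [nat] to allow induction. *)
Definition l1 (q : {poly int}) : nat := (\sum_(i < size q) absz (q`_i)%R)%N.

Lemma l1_widen (n : nat) (q : {poly int}) : (size q <= n)%N ->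
  l1 q = (\sum_(i < n) absz (q`_i)%R)%N.
Proof.
move=> size_q; rewrite /l1 (big_ord_widen _ (fun i => absz q`_i) size_q).
rewrite big_mkcond; apply: eq_bigr => i _; case: ltnP => // i_ge.
by rewrite nth_default.
Qed.

Lemma l1D (q r : {poly int}) : (l1 (q + r)%R <= l1 q + l1 r)%N.
Proof.
rewrite (l1_widen (size_polyD q r)) (l1_widen (leq_maxl (size q) (size r))).
rewrite (l1_widen (leq_maxr (size q) (size r))) -big_split /=.
by apply: leq_sum => i _; rewrite coefD; move: (q`_i) (r`_i) => x y; lia.
Qed.

Lemma l1_sum (n : nat) (F : nat -> {poly int}) :
  (l1 (\sum_(i < n) F i)%R <= \sum_(i < n) l1 (F i))%N.
Proof.
apply: (big_ind2 (fun q m => l1 q <= m)%N) => // [|q m r k qm rk].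
  by rewrite /l1 size_poly0 big_ord0.
by rewrite (leq_trans (l1D q r)) ?leq_add.
Qed.

Lemma l1MXn (q : {poly int}) (n : nat) : l1 (q * 'X^n) = l1 q.
Proof.
have size_qX : (size (q * 'X^n)%R <= n + size q)%N.
  by rewrite (leq_trans (size_polyMleq _ _)) // size_polyXn addnS addnC.
rewrite (l1_widen size_qX) big_split_ord /= big1 => [|i _].
  by rewrite add0n; apply: eq_bigr => i _; rewrite coefMXn ltnNge leq_addr addKn.
by rewrite coefMXn ltn_ord.
Qed.

Lemma l1_sgz_scale (c : int) (q : {poly int}) : (l1 (sgz c *: q)%R <= l1 q)%N.
Proof.
rewrite (l1_widen (size_scale_leq _ _)); apply: leq_sum => i _.
by rewrite coefZ abszM; case: sgzP; rewrite ?mul0n ?mul1n.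
Qed.

(** The digit sum of [n] is compared termwise with [n], the sum of the digits weighted by [B^i]. The
    [leqif] form records the equality case, which [leqif_sum] then carries over to sums of several
    expansions. *)
Lemma l1_base_poly (n B : nat) : (1 < B)%N ->
  (l1 (base_poly n B) <= n ?= iff (n < B))%N.
Proof.
move=> B_gt1; set q := base_poly n B.
have digit_ge0 i : 0 <= q`_i by case/andP: (base_poly_digit n i B_gt1).
have nE : n = (\sum_(i < size q) absz (q`_i)%R * B ^ i)%N.
  apply/eqP; rewrite -(inj_eq (@can_inj _ _ _ _ absz_nat)) //.
  rewrite -(@base_poly_eval n B) ?(ltnW B_gt1) // horner_coef -[X in _ == X]natz.
  rewrite natr_sum; apply/eqP/eq_bigr => i _.
  by rewrite natrM natrX !natz gez0_abs.
have [n_lt|n_ge] := ltnP n B.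
  have -> : l1 q = n; last exact/leqif_refl.
  by rewrite /q base_poly_small // (l1_widen (size_polyC_leq1 _)) big_ord1 coefC.
have le_i (i : 'I_(size q)) : true ->
    (absz (q`_i)%R <= absz (q`_i)%R * B ^ i
       ?= iff (absz (q`_i)%R == absz (q`_i)%R * B ^ i))%N.
  by split=> //; rewrite leq_pmulr // expn_gt0 ltnW.
have [l1_le l1_eq] := leqif_sum le_i; rewrite -nE in l1_le l1_eq.
split=> //; apply: contraTF n_ge => l1E; rewrite -ltnNge.
move: l1_eq; rewrite l1E => /esym/forallP /= eq_i.
(* Equality in each term kills every digit of positive index, since its weight exceeds 1; only the
   lowest digit is left. *)
have -> : n = absz q`_0; last by have := base_poly_digit n 0 B_gt1; rewrite -/q; lia.
rewrite [LHS]nE; case size_q: (size q) => [|m].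
  by rewrite big_ord0 nth_default // size_q.
rewrite big_ord_recl muln1 big1 ?addn0 // => i _; rewrite lift0.
have i_lt : (i.+1 < size q)%N by rewrite size_q ltnS.
have /eqP := eq_i (Ordinal i_lt); rewrite /=.
have : (1 < B ^ i.+1)%N by rewrite -(exp1n i.+1) ltn_exp2r.
by move: (absz _) (B ^ _)%N => x y; nia.
Qed.

Lemma l1_expand_coefs (h : {poly int}) (B : nat) : (1 < B)%N ->
  ~ coefs_small B h -> (l1 (expand_coefs B h) < l1 h)%N.
Proof.
move=> B_gt1 h_big.
pose F i : {poly int} := sgz h`_i *: base_poly (absz h`_i) B * 'X^i.
apply: leq_ltn_trans (l1_sum (size h) F) _.
have F_le : (\sum_(i < size h) l1 (F i)
             <= \sum_(i < size h) l1 (base_poly (absz (h`_i)%R) B))%N.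
  by apply: leq_sum => i _; rewrite l1MXn l1_sgz_scale.
apply: leq_ltn_trans F_le _.
(* Equality of the two sums would mean equality in every term, that is, every coefficient already
   small. *)
rewrite (ltn_leqif (leqif_sum (fun (i : 'I_(size h)) _ =>
                                 l1_base_poly (absz h`_i) B_gt1))).
apply/negP => /forallP /= small; apply: h_big => i.
have [i_lt|i_ge] := ltnP i (size h).
  by have := small (Ordinal i_lt); rewrite /=; lia.
by rewrite nth_default //; lia.
Qed.

Lemma expand_coefs_eval (h : {poly int}) (B : nat) : (0 < B)%N ->
  (expand_coefs B h).[B%:Z] = h.[B%:Z].
Proof.
move=> B_gt0; rewrite horner_sum horner_coef; apply: eq_bigr => i _.
by rewrite hornerM hornerZ base_poly_eval // hornerXn -intEsg.
Qed.

Lemma expand_loop_terminates (h : {poly int}) (B : nat) : (1 < B)%N ->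
  exists h', expand_loop B h h'.
Proof.
(* The measure is taken after one expansion: the loop always expands at least once, and that first
   step need not decrease [l1] when [h] is already small. *)
move=> B_gt1; have [n] := ubnP (l1 (expand_coefs B h)).
elim: n h => // n IHn h; rewrite ltnS => le_n.
(* [coefs_small] ranges over all indices; testing the finitely many stored coefficients decides
   it. *)
have [/allP small|/allPn big] :=
  boolP (all (fun c : int => `|c| < B%:Z) (expand_coefs B h)).
  exists (expand_coefs B h); apply: Expand_stop => i.
  have [i_lt|i_ge] := ltnP i (size (expand_coefs B h)).
    by apply/small/mem_nth.
  by rewrite nth_default //; lia.
have not_small : ~ coefs_small B (expand_coefs B h).
  case: big => c /(nthP 0)[i _ <-] /negP big_i small; exact: big_i (small i).
have [|h' loop_h'] := IHn (expand_coefs B h).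
  by rewrite (leq_trans _ le_n) // l1_expand_coefs.
by exists h'; apply: Expand_again.
Qed.

Lemma expand_loop_small (h h' : {poly int}) (B : nat) :
  expand_loop B h h' -> coefs_small B h'.
Proof. by elim. Qed.

Lemma expand_loop_eval (h h' : {poly int}) (B : nat) : (0 < B)%N ->
  expand_loop B h h' -> h'.[B%:Z] = h.[B%:Z].
Proof.
move=> B_gt0; elim=> [q _|q q' _ _ ->]; exact: expand_coefs_eval.
Qed.

(** * Correctness of the ascent and generation of all base expansions of [p] *)

(** Left to right, every run of the procedure has the expected output, by uniqueness of base
    expansions. Right to left, a run exists: the loop terminates and its result has a base-x
    representation. *)
Lemma ascent_base_poly (p b a : nat) (g : {poly int}) :
  (0 < p)%N -> (0 < b)%N -> (0 < a)%N ->
  ascent b a (base_poly p b) g <-> g = base_poly p (b + a).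
Proof.
move=> p_gt0 b_gt0 a_gt0; have B_gt1 : (1 < b + a)%N by lia.
set f := base_poly p b \Po ('X - a%:Z%:P).
have loop_eval h : expand_loop (b + a) f h -> h.[(b + a)%N%:Z] = p%:Z.
  move=> /(expand_loop_eval (ltnW B_gt1)) ->; rewrite horner_comp hornerXsubC.
  by rewrite PoszD addrK base_poly_eval.
have subst_rep h s : expand_loop (b + a) f h -> base_x_rep h s ->
    digits_sum (fun d => (digit_subst (b + a) d)%:P) s = base_poly p (b + a).
  move=> loop_h [ok_s _ h_s]; rewrite -/(digits_sum _ _) in h_s.
  apply: digits_sum_subst => //; last by rewrite -h_s loop_eval.
  by apply: small_digit_lt; rewrite -h_s; apply: expand_loop_small loop_h.
split=> [[h [s [loop_h rep_s ->]]]|->]; first exact: subst_rep loop_h rep_s.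
have [h loop_h] := expand_loop_terminates f B_gt1.
(* A representation requires a positive leading coefficient, which follows from small coefficients
   and [h(b + a) = p > 0]. *)
have [|s rep_s] := @base_x_rep_exists h.
  by apply: small_lead_gt0 (expand_loop_small loop_h) _; rewrite loop_eval.
by exists h, s; split=> //; rewrite -(subst_rep h s).
Qed.

Lemma base_poly_generable (p b : nat) : prime p -> (0 < b)%N ->
  generable p (base_poly p b).
Proof.
move=> p_pr b_gt0; have [->|b_neq1] := eqVneq b 1%N.
  by rewrite base_poly1_Phi //; exact: Gen_seed.
(* The seed is the base-1 expansion, so a single ascent by [b - 1] reaches base [b]. *)
apply: (@Gen_ascent p 1 b.-1); rewrite ?base_poly1_Phi //; first by lia.
  exact: Gen_seed.
rewrite -base_poly1_Phi //; apply/ascent_base_poly => //; first exact: prime_gt0.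
  by lia.
by rewrite add1n prednK.
Qed.

(** * Recovering a polynomial from the values of its linear digits *)

Lemma sum_ord_widen (V : nmodType) (m n : nat) (F : nat -> V) : (m <= n)%N ->
  (forall i, (m <= i)%N -> F i = 0) -> \sum_(i < m) F i = \sum_(i < n) F i.
Proof.
move=> le_mn F0; rewrite (big_ord_widen _ F le_mn) big_mkcond.
by apply: eq_bigr => i _; case: ltnP => // /F0.
Qed.

(** Substitution turns [x - j] into the coefficient [b - j], and linearizing there gives
    [x - (b - (b - j)) = x - j]; so the selected indices are the positions of the linear digits. *)
Lemma linearize_subst (b : nat) (s : seq digit) :
  linearize b [seq i <- iota 0 (size s) | is_lin (nth (Cst 0) s i)]
    (digits_sum (fun d => (digit_subst b d)%:P) s) = digits_sum digit_poly s.
Proof.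
rewrite /linearize; set I := filter _ _; set f := digits_sum _ s.
have in_I i : (i \in I) = is_lin (nth (Cst 0) s i).
  rewrite mem_filter mem_iota /= andb_idr // => lin_i.
  by rewrite ltnNge; apply: contraTN lin_i => /(nth_default _) ->.
(* The sum in [linearize] has length [n], the target has length [size s]; the terms [F i] vanish
   beyond either bound. *)
set n := maxn _ _.
pose F i : {poly int} := digit_poly (nth (Cst 0) s i) * 'X^i.
transitivity (\sum_(i < n) F i).
  apply: eq_bigr => i _; rewrite in_I coef_digits_sum_subst /F.
  by case: (nth _ _ _) => j //=; rewrite subKr.
have F0 i : (size s <= i)%N -> F i = 0.
  by move=> le_i; rewrite /F nth_default //= polyC0 mul0r.
(* From [n] on, the index is not in [I], so the digit is constant and equals the coefficient of [f]
   there, which is 0. *)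
have F0' i : (n <= i)%N -> F i = 0.
  rewrite geq_max => /andP[size_f max_I]; rewrite /F.
  have : i \notin I.
    apply: contraTN max_I => I_i; rewrite -ltnNge.
    exact: (@leq_bigmax_seq _ I predT succn i).
  have := coef_digits_sum_subst b s i; rewrite -/f nth_default // in_I.
  by case: (nth _ _ _) => //= j <- _; rewrite polyC0 mul0r.
by case/orP: (leq_total n (size s)) => le_n;
   [rewrite (sum_ord_widen le_n F0') | rewrite -(sum_ord_widen le_n F0)].
Qed.

(** Digit bounds for [a] persist for [b >= a], so for [b >= 2] the values of the digits at [b] form
    the base-[b] expansion of [p], from which [g] arises by linearization. *)
Lemma rep_generable (p a b : nat) (g : {poly int}) (s : seq digit) :
  prime p -> (0 < a <= b)%N -> base_x_rep g s -> all (digit_lt a) s ->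
  g.[b%:Z] = p%:Z -> generable p g.
Proof.
move=> p_pr /andP[a_gt0 le_ab] [ok_s _ g_s] lt_s; rewrite -/(digits_sum _ _) in g_s.
rewrite g_s => s_eval.
have lt_b : all (digit_lt b) s.
  apply: sub_all lt_s => -[] n /= le_n; first exact: leq_trans le_n le_ab.
  exact: leq_trans le_n le_ab.
have [b_gt1|b_le1] := ltnP 1 b.
  rewrite -(linearize_subst b) (digits_sum_subst b_gt1 ok_s lt_b s_eval).
  by apply: Gen_linearize; [lia|apply: base_poly_generable => //; lia].
(* In base 1 only the digits 0 and x - 1 are available, and both vanish at 1. *)
have b1 : b = 1%N by lia.
have := prime_gt0 p_pr; suff : (p%:Z == 0) by lia.
rewrite -s_eval -digits_sum_subst_eval horner_sum big1 // => i _.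
rewrite hornerM hornerC (_ : digit_subst _ _ = 0) ?mul0r //.
have ok_i : digit_ok (nth (Cst 0) s i) by apply: all_nthP.
have lt_i : digit_lt b (nth (Cst 0) s i) by apply: all_nthP.
by have := digit_subst_bound ok_i lt_i; lia.
Qed.

Theorem theorem7 (p : nat) (p_prime : prime p) :
  (forall (b a : nat) (g : {poly int}), (0 < b)%N -> (0 < a)%N ->
     ascent b a (base_poly p b) g <-> g = base_poly p (b + a)) /\
  (forall g : {poly int}, prime_family p g -> generable p g).
Proof.
split=> [b a g|g]; first exact/ascent_base_poly/prime_gt0.
case=> [->|->|[_ [a [b [[s rep_s [a_gt0 lt_s _]] le_ab g_eval]]]]].
(* The constant [p] is its own one-digit expansion in base [p + 1]. *)
- rewrite -(@base_poly_small p p.+1) ?ltnS ?prime_gt0 //.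
  exact: base_poly_generable.
- exact: Gen_seed.
(* The bound [a <= b] excludes negative [b]. *)
case: b => // b in le_ab g_eval *.
by apply: (rep_generable p_prime _ rep_s lt_s g_eval); rewrite a_gt0.
Qed.
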